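(* Let $q\in\mathbb{N}_0$ and let $\nu$ be a charge on $\mathbb{C}$ such that for some $r_0>0$ the integrals $\int_{D(r_0)\cap\mathbb{C}^{\rm up}}\operatorname{Im}\frac1{z^k}d\nu(z)$, $1\le k\le q$, converge, and such that the restriction of $\nu$ to $\mathbb{C}^{\rm up}$ belongs to the convergence class at order of growth $q+1$ near $\infty$. Then the balayage $\nu^{\mathrm{bal}[q]}$ of genus $q$ exists as a charge on $\mathbb{C}$. If moreover $D(r_0)\cap\operatorname{supp}\nu=\varnothing$ for some $r_0>0$, then $|\nu^{\mathrm{bal}[q]}|^{\rm rad}(t)=O(t^{q+1})$ as $t\to0$.
   Context: A charge is a real Borel signed measure on $\mathbb{C}$ finite on bounded sets, $|\nu|$ its total variation, $|\nu|^{\rm rad}(r)=|\nu|(\{|z|\le r\})$, $D(r)=\{|z|<r\}$, $\mathbb{C}^{\rm up}=\{\operatorname{Im}z>0\}$. A charge $\mu$ belongs to the convergence class at order of growth $s$ near $\infty$ if $\int_1^{+\infty}t^{-s}d|\mu|^{\rm rad}(t)<\infty$. For $z\in\mathbb{C}^{\rm up}$ and bounded Borel $B$: $\Omega^{[q]}(z,B)=\frac1\pi\int_{B\cap\mathbb{R}}\operatorname{Im}\frac1{t-z}dt+\frac1\pi\sum_{k=1}^q\operatorname{Im}(z^{-k})\int_{B\cap\mathbb{R}}t^{k-1}dt$; the balayage of genus $q$ from $\mathbb{C}^{\rm up}$ is $\nu^{\mathrm{bal}[q]}(B)=\int_{\mathbb{C}^{\rm up}}\Omega^{[q]}(z,B)d\nu(z)+\nu(B\setminus\mathbb{C}^{\rm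 up})$ (existence meaning the integrals converge and define a charge). *)

(* Defs.v *)
From mathcomp Require Import all_boot all_algebra.
From mathcomp Require Import all_classical all_reals all_analysis.
From mathcomp Require Import complex.
Set Implicit Arguments. Unset Strict Implicit. Unset Printing Implicit Defensive.
Import GRing.Theory Num.Theory.
Local Open Scope classical_set_scope.
Local Open Scope ring_scope.

(* The complex plane is modelled as R * R (with its Borel = product
   sigma-algebra); z = (x, y) stands for x + i y. *)
Section Defs.
Variable R : realType.
Local Notation CC := (R * R)%type.

Definition toC (z : CC) : R[i] := (z.1 +i* z.2)%C.

Definition cabs (z : CC) : R := Num.sqrt (z.1 ^+ 2 + z.2 ^+ 2).

Definition Cup : set CC := [set z | 0 < z.2].

Definition odisc (r : R) : set CC := [set z | cabs z < r].
Definition cdisc (r : R) : set CC := [set z | cabs z <= r].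

Definition odisc_at (z : CC) (e : R) : set CC :=
  [set w | cabs (w.1 - z.1, w.2 - z.2) < e].

Definition bounded_set (B : set CC) : Prop := exists r : R, B `<=` cdisc r.

(* A charge nu (real Borel signed measure on C, finite on bounded sets)
   is represented by its Jordan decomposition nu = nup - nun:
   nup, nun are (positive) Borel measures, finite on bounded sets and
   mutually singular; then |nu| = nup + nun. *)
Definition is_charge (nup nun : {measure set CC -> \bar R}) : Prop :=
  (forall r : R, (nup (cdisc r) < +oo)%E /\ (nun (cdisc r) < +oo)%E) /\
  exists A : set CC, measurable A /\ nup A = 0%E /\ nun (~` A) = 0%E.

Definition charge_val (nup nun : {measure set CC -> \bar R}) (B : set CC) : R :=
  fine (nup B) - fine (nun B).

Definition charge_abs (nup nun : {measure set CC -> \bar R}) :=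
  measure_add nup nun.

Definition charge_supp (nup nun : {measure set CC -> \bar R}) : set CC :=
  [set z | forall e : R, 0 < e -> (0 < charge_abs nup nun (odisc_at z e))%E].

Definition real_trace (B : set CC) : set R := [set t | B (t, 0)].

Definition Omega (q : nat) (z : CC) (B : set CC) : R :=
  pi^-1 * (Rintegral lebesgue_measure (real_trace B)
             (fun t : R => complex.Im (((t +i* 0)%C - toC z)^-1))
           + \sum_(1 <= k < q.+1)
               complex.Im ((toC z) ^- k) *
               Rintegral lebesgue_measure (real_trace B)
                 (fun t : R => t ^+ (k.-1))).

Definition bal (q : nat) (nup nun : {measure set CC -> \bar R})
    (B : set CC) : R :=
  Rintegral nup Cup (fun z => Omega q z B)
  - Rintegral nun Cup (fun z => Omega q z B)
  + charge_val nup nun (B `\` Cup).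

Definition bal_exists (q : nat) (nup nun : {measure set CC -> \bar R}) : Prop :=
  (forall B : set CC, measurable B -> bounded_set B ->
     nup.-integrable Cup (fun z => (Omega q z B)%:E) /\
     nun.-integrable Cup (fun z => (Omega q z B)%:E)) /\
  exists mup mun : {measure set CC -> \bar R},
    is_charge mup mun /\
    forall B : set CC, measurable B -> bounded_set B ->
      bal q nup nun B = charge_val mup mun B.

Definition tvar (m : set CC -> R) (A : set CC) : \bar R :=
  ereal_sup [set x | exists (n : nat) (F : 'I_n -> set CC),
    (forall i, measurable (F i)) /\
    (forall i j, i != j -> F i `&` F j = set0) /\
    A = \big[setU/set0]_(i < n) F i /\
    x = (\sum_(i < n) `|m (F i)|)%:E].

End Defs.
Arguments Cup {R}.

(* Main.v *)
(* For real t, Im 1/(t-z) + sum_(1 <= k <= q) Im(z^-k) t^(k-1) is the imaginary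
   part of (t/z)^q / (t-z), hence O(|t|^q / |z|^(q+1)) as soon as |z| >= 2|t|;
   the convergence class at order q+1 makes this integrable far from 0, while
   for bounded z the Poisson term has integral at most pi and the remaining
   terms are integrable near 0 by hypothesis. By Tonelli, integrating the
   positive and the negative part of the kernel separately writes the balayage
   as a difference P - N of two measures finite on bounded sets. Neither P - N
   nor its parts need be finite on the whole plane, so the Jordan decomposition
   is glued from Hahn decompositions on the annuli n <= |z| < n+1. When nu does
   not charge a disc about 0, only the O(|t|^q / |z|^(q+1)) regime occurs in a
   small disc {|z| <= t}, and integrating it over [-t, t] gives t^(q+1). *)
From HB Require Import structures.
Require Import Defs.
From mathcomp Require Import all_boot all_order all_algebra.
From mathcomp Require Import all_classical all_reals all_analysis.
From mathcomp Require Import measurable_realfun.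
From mathcomp Require Import complex.
From mathcomp Require Import ring lra.
Import Order.TTheory GRing.Theory Num.Theory.
Import numFieldNormedType.Exports.
Local Open Scope classical_set_scope.
Local Open Scope ring_scope.

Set Implicit Arguments.
Unset Strict Implicit.
Unset Printing Implicit Defensive.

(** * Jordan decomposition of a difference of measures *)

(** On each piece [A n] the difference P - N is a finite signed measure and has a Hahn
    decomposition. The positive and the negative parts are summed separately over the pieces;
    disjointness of the pieces keeps the two sums mutually singular. The identity is stated only
    inside finitely many pieces, since [fine] sends an infinite value to 0. *)
Lemma sigma_finite_jordan_decomposition (d : measure_display)
    (T : measurableType d) (R : realType) (P N : {measure set T -> \bar R})
    (A : (set T)^nat) :
  (forall n, measurable (A n)) -> trivIset setT A ->
  (forall n, (P (A n) < +oo)%E) -> (forall n, (N (A n) < +oo)%E) ->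
  \bigcup_n A n = setT ->
  exists mup mun : {measure set T -> \bar R},
    (exists D, [/\ measurable D, mup D = 0%E & mun (~` D) = 0%E]) /\
    forall n B, measurable B -> B `<=` \bigcup_(i < n) A i ->
      [/\ (mup B < +oo)%E, (mun B < +oo)%E &
          fine (mup B) - fine (mun B) = fine (P B) - fine (N B)].
Proof.
move=> mA tA PA NA cA.
pose c k : {charge set T -> \bar R} :=
  cadd (charge_of_finite_measure (mfrestr (mA k) (PA k)))
       (copp (charge_of_finite_measure (mfrestr (mA k) (NA k)))).
have cE k B : c k B = (P (B `&` A k) - N (B `&` A k))%E by [].
have fP k B : measurable B -> P (B `&` A k) \is a fin_num.
  move=> mB; rewrite ge0_fin_numE ?measure_ge0//.
  apply: le_lt_trans (PA k); apply: le_measure; rewrite ?inE//.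
  exact: measurableI.
have fN k B : measurable B -> N (B `&` A k) \is a fin_num.
  move=> mB; rewrite ge0_fin_numE ?measure_ge0//.
  apply: le_lt_trans (NA k); apply: le_measure; rewrite ?inE//.
  exact: measurableI.
have /choice[H hH] k : exists X : set T * set T, hahn_decomposition (c k) X.1 X.2.
  by have [X1 [X2 hX]] := Hahn_decomposition (c k); exists (X1, X2).
have mH2 k : measurable (H k).2 by case: (hH k) => _ [].
have H12 k : (H k).1 `&` (H k).2 = set0 by case: (hH k).
pose mup : {measure set T -> \bar R} := mseries (fun k => jordan_pos (hH k)) 0.
pose mun : {measure set T -> \bar R} := mseries (fun k => jordan_neg (hH k)) 0.
have jpE k B : measurable B ->
    jordan_pos (hH k) B = (P (B `&` (H k).1 `&` A k) - N (B `&` (H k).1 `&` A k))%E.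
  by move=> mB; rewrite jordan_posE cjordan_posE /crestr0 mem_set.
have jnE k B : measurable B ->
    jordan_neg (hH k) B = (- (P (B `&` (H k).2 `&` A k) - N (B `&` (H k).2 `&` A k)))%E.
  by move=> mB; rewrite jordan_negE cjordan_negE /crestr0 mem_set.
exists mup, mun; split.
  (* [D] glues the negative Hahn sets, each cut to its own piece, so that it meets [A k] only in the
     negative set of index k. *)
  pose D := \bigcup_k (A k `&` (H k).2); exists D.
  have mD : measurable D.
    by apply: bigcup_measurable => k _; exact: measurableI.
  split => //.
  - apply: eseries0 => k _ _; rewrite [LHS](jpE k _ mD).
    suff -> : D `&` (H k).1 `&` A k = set0 by rewrite !measure0 sube0.
    rewrite -subset0 => x [[[j _ [Aj Hj]] Hk] Ak].
    have jk : j = k by apply: tA => //; exists x.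
    by rewrite jk in Hj; rewrite -(H12 k).
  - apply: eseries0 => k _ _; rewrite [LHS](jnE k _ (measurableC mD)).
    suff -> : ~` D `&` (H k).2 `&` A k = set0 by rewrite !measure0 sube0 oppe0.
    by rewrite -subset0 => x [[Dx Hk] Ak]; apply: Dx; exists k.
move=> n B mB BA.
(* Pieces of index at least n miss [B], so both series below reduce to finite sums. *)
have BA0 k X : (n <= k)%N -> B `&` X `&` A k = set0.
  move=> nk; rewrite -subset0 => x [[/BA[j /= jn Aj] _] Ak].
  have jk : j = k by apply: tA => //; exists x.
  by move: jn; rewrite jk ltnNge nk.
have mupE : mup B = (\sum_(k < n) jordan_pos (hH k) B)%E.
  rewrite [LHS](nneseries_split _ n)//.
  rewrite add0n eseries0 ?adde0 ?big_mkord// => k nk _.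
  by rewrite [LHS](jpE k _ mB) BA0// !measure0 sube0.
have munE : mun B = (\sum_(k < n) jordan_neg (hH k) B)%E.
  rewrite [LHS](nneseries_split _ n)//.
  rewrite add0n eseries0 ?adde0 ?big_mkord// => k nk _.
  by rewrite [LHS](jnE k _ mB) BA0// !measure0 sube0 oppe0.
have jpf k : jordan_pos (hH k) B \is a fin_num by exact: fin_num_measure.
have jnf k : jordan_neg (hH k) B \is a fin_num by exact: fin_num_measure.
have BE : B = \big[setU/set0]_(k < n) (B `&` A k).
  by rewrite -(big_mkord xpredT (fun k => B `&` A k)) -big_distrr/= big_mkord
    -bigcup_mkord; apply/esym/setIidPl.
have QE (Q : {measure set T -> \bar R}) : Q B = (\sum_(k < n) Q (B `&` A k))%E.
  rewrite [LHS](congr1 Q BE) (measure_semi_additive_ord_I Q (F := fun k => B `&` A k))//.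
  - by move=> k _; exact: measurableI.
  - move=> i j _ _ [x [[_ Ai] [_ Aj]]]; apply: tA => //; by exists x.
  - by apply: bigsetU_measurable => k _; exact: measurableI.
split.
- by rewrite mupE -ge0_fin_numE ?sume_ge0//; apply/sum_fin_numP => k _ _.
- by rewrite munE -ge0_fin_numE ?sume_ge0//; apply/sum_fin_numP => k _ _.
rewrite mupE munE (QE P) (QE N) -!sum_fine; last 4 first.
- by move=> k _; exact: fN.
- by move=> k _; exact: fP.
- by [].
- by [].
rewrite -!sumrB; apply: eq_bigr => k _.
rewrite -fineB// -fineB ?fP ?fN//; congr fine.
by rewrite -cE (jordan_decomp (hH k) mB) /cadd /= cscaleN1.
Qed.

(** * Measures defined by iterated integrals *)

(** Extending f by 0 off the strip over [B] turns the integral over [B] into one over the whole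
    second factor, where Tonelli gives measurability. *)
Lemma measurable_fun_section_integral (d1 d2 : measure_display)
    (T1 : measurableType d1) (T2 : measurableType d2) (R : realType)
    (m2 : {sigma_finite_measure set T2 -> \bar R}) (f : (T1 * T2)%type -> \bar R)
    (B : set T2) :
  measurable B -> measurable_fun [set: T1 * T2] f -> (forall p, (0 <= f p)%E) ->
  measurable_fun setT (fun x => (\int[m2]_(y in B) (f (x, y) : \bar R))%E).
Proof.
move=> mB mf f0.
have mTB : measurable ([set: T1] `*` B) by exact: measurableX.
have mfB : measurable_fun setT (f \_ (setT `*` B)).
  by apply/(measurable_restrictT f mTB); exact: measurable_funTS.
have := @measurable_fun_fubini_tonelli_F _ _ T1 T2 R m2 _ mfB.
rewrite (_ : fubini_F _ _ =
    (fun x => (\int[m2]_(y in B) (f (x, y) : \bar R))%E)); first apply.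
  by move=> p; exact: erestrict_ge0.
apply/funext => x; rewrite /fubini_F [RHS]integral_mkcond.
apply: eq_integral => y _; rewrite /patch /=.
by congr (if _ then _ else _); apply/idP/idP; rewrite !inE; [move=> []|move=> yB; split].
Qed.

(** Countable additivity passes through the inner integral over a disjoint union of preimages, then
    through the outer one by monotone convergence. The map [g] is there to push a measure on the
    real line into the plane. *)
Lemma iterated_integral_measure (d1 d2 d3 : measure_display)
    (T1 : measurableType d1) (T2 : measurableType d2) (T3 : measurableType d3)
    (R : realType) (m1 : {measure set T1 -> \bar R})
    (m2 : {sigma_finite_measure set T2 -> \bar R}) (D : set T1) (g : T2 -> T3)
    (f : (T1 * T2)%type -> \bar R) :
  measurable D -> measurable_fun setT g -> measurable_fun [set: T1 * T2] f ->
  (forall p, (0 <= f p)%E) ->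
  exists mu : {measure set T3 -> \bar R}, forall B,
    mu B = (\int[m1]_(x in D) \int[m2]_(y in g @^-1` B) f (x, y))%E.
Proof.
move=> mD mg mf f0.
pose mu B := (\int[m1]_(x in D) \int[m2]_(y in g @^-1` B) f (x, y))%E.
have mgB B : measurable B -> measurable (g @^-1` B).
  by move=> mB; rewrite -[_ @^-1` _]setTI; exact: mg.
have mu0 : mu set0 = 0%E.
  by rewrite /mu preimage_set0; apply: integral0_eq => x _; rewrite integral_set0.
have mu_ge0 B : (0 <= mu B)%E.
  by apply: integral_ge0 => x _; exact: integral_ge0.
have mu_sigma : semi_sigma_additive mu.
  move=> F mF tF mUF.
  have -> : mu (\bigcup_n F n) = (\sum_(n <oo) mu (F n))%E.
    rewrite /mu -integral_nneseries//.
    - apply: eq_integral => x _; rewrite preimage_bigcup ge0_integral_bigcup//.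
      + by move=> k; exact: mgB.
      + by apply: measurable_funTS; exact: measurableT_comp.
      + by move=> i j _ _ [y [Fi Fj]]; apply: tF => //; exists (g y).
    - move=> n; apply: measurable_funTS.
      by apply: measurable_fun_section_integral => //; exact: mgB.
    - by move=> n x _; exact: integral_ge0.
  by apply: is_cvg_ereal_nneg_natsum => k _; exact: mu_ge0.
pose mum := @isMeasure.Build _ _ _ mu mu0 mu_ge0 mu_sigma.
pose mum' : {measure set T3 -> \bar R} := HB.pack mu mum.
by exists mum'.
Qed.

(** * The kernel of the balayage of genus q *)

Section complex_auxiliary.
Context {R : realType}.
Implicit Types (z w : R[i]) (t : R).
Local Open Scope complex_scope.

Lemma ImD z w : complex.Im (z + w) = complex.Im z + complex.Im w.
Proof. by case: z w => [a b] [c d]. Qed.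

Lemma Im_mul_real z t : complex.Im (z * t%:C) = complex.Im z * t.
Proof. by case: z => a b /=; rewrite mulr0 add0r. Qed.

Lemma ler_norm_Im z : `|complex.Im z| <= ComplexField.Normc.normc z.
Proof.
by case: z => a b /=; rewrite -sqrtr_sqr ler_wsqrtr// lerDr sqr_ge0.
Qed.

Lemma normcX z n : ComplexField.Normc.normc (z ^+ n) = ComplexField.Normc.normc z ^+ n.
Proof.
elim: n => [|n IH]; first by rewrite !expr0 ComplexField.Normc.normc1.
by rewrite !exprS ComplexField.Normc.normcM IH.
Qed.

Lemma normc_real t : ComplexField.Normc.normc t%:C = `|t|.
Proof. by rewrite /= expr0n/= addr0 sqrtr_sqr. Qed.

(** The sum telescopes: (t/z)^(q+1)/(t-z) - (t/z)^q/(t-z) = t^q / z^(q+1), whose imaginary part is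
    the term of index k = q+1. *)
Lemma genus_kernelE (q : nat) z t : z != 0 -> t%:C != z ->
  complex.Im (t%:C - z)^-1
    + \sum_(1 <= k < q.+1) complex.Im (z ^- k) * t ^+ k.-1
  = complex.Im ((t%:C / z) ^+ q / (t%:C - z)).
Proof.
move=> z0 tz; have tz0 : t%:C - z != 0 by rewrite subr_eq0.
elim: q => [|q IH]; first by rewrite big_geq// addr0 expr0 mul1r.
rewrite big_nat_recr//= addrA IH -Im_mul_real -ImD rmorphXn/=.
congr complex.Im; rewrite !expr_div_n !exprS; field.
by rewrite tz0 expf_neq0 z0.
Qed.

(** When |t| is at most |z|/2, the triangle inequality gives |t - z| >= |z|/2; the factor 2 is the
    price of replacing 1/|t - z| by 1/|z|. *)
Lemma ler_genus_kernel (q : nat) z t : z != 0 ->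
  `|t| <= ComplexField.Normc.normc z / 2 ->
  `|complex.Im (t%:C - z)^-1
    + \sum_(1 <= k < q.+1) complex.Im (z ^- k) * t ^+ k.-1|
  <= 2 * `|t| ^+ q * ComplexField.Normc.normc z ^- q.+1.
Proof.
move=> z0 tz; set r := ComplexField.Normc.normc z in tz *.
have r0 : 0 < r.
  rewrite lt_neqAle; apply/andP; split; last first.
    by rewrite /r; case: (z) => a b; exact: sqrtr_ge0.
  by apply: contra_neq z0 => /esym; exact: ComplexField.Normc.eq0_normc.
have dist : r / 2 <= ComplexField.Normc.normc (t%:C - z).
  have : r <= ComplexField.Normc.normc (t%:C - z) + `|t|.
    rewrite -normc_real -[X in _ <= X + _]normcN opprB /r.
    by rewrite -{1}(subrK t%:C z); exact: le_normcD.
  lra.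
have tz0 : t%:C != z.
  by apply: contraTneq dist => ->; rewrite subrr ComplexField.Normc.normc0 -ltNge; lra.
rewrite genus_kernelE//; apply: (le_trans (ler_norm_Im _)).
rewrite ComplexField.Normc.normcM normcX ComplexField.Normc.normcM normc_real.
rewrite !ComplexField.Normc.normcV -/r expr_div_n.
have -> : 2 * `|t| ^+ q * r ^- q.+1 = `|t| ^+ q / r ^+ q * (r / 2)^-1.
  by rewrite exprS; field; rewrite gt_eqF//= expf_neq0// gt_eqF.
rewrite ler_wpM2l//; first by rewrite divr_ge0// exprn_ge0// ltW.
by rewrite lef_pV2// posrE ?(lt_le_trans _ dist)// divr_gt0.
Qed.

End complex_auxiliary.

(** * Measurability of the kernel *)

Definition measurable_cfun (d : measure_display) (T : measurableType d)
    (R : realType) (f : T -> R[i]) :=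
  measurable_fun setT (fun x => complex.Re (f x)) /\
  measurable_fun setT (fun x => complex.Im (f x)).

Section measurable_cfun.
Context (d : measure_display) (T : measurableType d) (R : realType).
Implicit Types f g : T -> R[i].

Lemma measurable_cfunB f g : measurable_cfun f -> measurable_cfun g ->
  measurable_cfun (fun x => f x - g x).
Proof.
move=> [f1 f2] [g1 g2]; split.
  rewrite (_ : (fun _ => _) = (fun x => complex.Re (f x) - complex.Re (g x))).
    exact: measurable_funB.
  by apply/funext => x; case: (f x) (g x) => [a b] [].
rewrite (_ : (fun _ => _) = (fun x => complex.Im (f x) - complex.Im (g x))).
  exact: measurable_funB.
by apply/funext => x; case: (f x) (g x) => [a b] [].
Qed.

Lemma measurable_cfunM f g : measurable_cfun f -> measurable_cfun g ->
  measurable_cfun (fun x => f x * g x).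
Proof.
move=> [f1 f2] [g1 g2]; split.
  rewrite (_ : (fun _ => _) = (fun x => complex.Re (f x) * complex.Re (g x)
                                      - complex.Im (f x) * complex.Im (g x))).
    by apply: measurable_funB; exact: measurable_funM.
  by apply/funext => x; case: (f x) (g x) => [a b] [].
rewrite (_ : (fun _ => _) = (fun x => complex.Re (f x) * complex.Im (g x)
                                    + complex.Im (f x) * complex.Re (g x))).
  by apply: measurable_funD; exact: measurable_funM.
by apply/funext => x; case: (f x) (g x) => [a b] [].
Qed.

Lemma measurable_cfunV f : measurable_cfun f -> measurable_cfun (fun x => (f x)^-1).
Proof.
move=> [f1 f2].
(* The reciprocal is rewritten as the real power -1; the two agree on nonnegative reals, including
   0, where both take the value 0. *)
have mV : measurable_fun setT
    (fun x => (complex.Re (f x) ^+ 2 + complex.Im (f x) ^+ 2)^-1).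
  rewrite (_ : (fun _ => _) =
      (fun x => (complex.Re (f x) ^+ 2 + complex.Im (f x) ^+ 2) `^ (-1))).
    apply: (measurableT_comp (f := fun y : R => y `^ (-1))).
      exact: measurable_powR.
    by apply: measurable_funD; exact: measurable_funX.
  by apply/funext => x; rewrite powR_inv1// addr_ge0// sqr_ge0.
split.
  rewrite (_ : (fun _ => _) = (fun x => complex.Re (f x) *
      (complex.Re (f x) ^+ 2 + complex.Im (f x) ^+ 2)^-1)).
    exact: measurable_funM.
  by apply/funext => x; case: (f x).
rewrite (_ : (fun _ => _) = (fun x => - (complex.Im (f x) *
    (complex.Re (f x) ^+ 2 + complex.Im (f x) ^+ 2)^-1))).
  by apply: measurable_funN; exact: measurable_funM.
by apply/funext => x; case: (f x) => a b /=.
Qed.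

Lemma measurable_cfunX f n : measurable_cfun f -> measurable_cfun (fun x => f x ^+ n).
Proof.
move=> mf; elim: n => [|n IH].
  by split; exact: measurable_cst.
by under eq_fun do rewrite exprS; exact: measurable_cfunM.
Qed.

End measurable_cfun.

(** The density of [Omega q z] with respect to Lebesgue measure on the real line, taken as a
    function of the pair (z, t) so that Tonelli can be applied to it. *)
Definition bal_kernel (R : realType) (q : nat) (p : R * R * R) : R :=
  pi^-1 * (complex.Im ((p.2 +i* 0)%C - toC p.1)^-1
    + \sum_(1 <= k < q.+1) complex.Im (toC p.1 ^- k) * p.2 ^+ k.-1).

Section bal_kernel.
Context {R : realType}.
Implicit Types (z : R * R) (t : R).

Lemma measurable_toC : measurable_cfun (@toC R).
Proof. by split; [exact: measurable_fst | exact: measurable_snd]. Qed.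

Lemma measurable_Im_toCX k :
  measurable_fun setT (fun z => complex.Im (toC z ^- k : R[i])).
Proof.
by have [] := measurable_cfunV (measurable_cfunX k measurable_toC).
Qed.

Lemma measurable_bal_kernel q : measurable_fun setT (@bal_kernel R q).
Proof.
apply: measurable_funM; first exact: measurable_cst.
apply: measurable_funD.
  have mt : measurable_cfun (fun p : R * R * R => toC p.1).
    by split; [exact: (measurableT_comp measurable_fst measurable_fst)
              |exact: (measurableT_comp measurable_snd measurable_fst)].
  have mp : measurable_cfun (fun p : R * R * R => (p.2 +i* 0)%C).
    by split; [exact: measurable_snd | exact: measurable_cst].
  by case: (measurable_cfunV (measurable_cfunB mp mt)).
apply: measurable_sum => k; apply: measurable_funM.
  exact: (measurableT_comp (measurable_Im_toCX k) measurable_fst).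
by apply: measurable_funX; exact: measurable_snd.
Qed.

Lemma normc_toC z : ComplexField.Normc.normc (toC z) = cabs z.
Proof. by []. Qed.

Lemma toC_eq0 z : (toC z == 0) = (cabs z == 0).
Proof.
apply/eqP/eqP; last exact: (ComplexField.Normc.eq0_normc (x := toC z)).
by rewrite -normc_toC => ->; exact: ComplexField.Normc.normc0.
Qed.

Lemma ler_bal_kernel q z t : 0 < cabs z -> `|t| <= cabs z / 2 ->
  `|bal_kernel q (z, t)| <= 2 * pi^-1 * `|t| ^+ q * cabs z ^- q.+1.
Proof.
move=> z0 tz; rewrite /bal_kernel/= normrM ger0_norm ?invr_ge0 ?pi_ge0//.
rewrite [2 * pi^-1]mulrC -!mulrA ler_wpM2l ?invr_ge0 ?pi_ge0// mulrA.
rewrite -normc_toC in z0 tz *.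
have zn0 : toC z != 0 by rewrite toC_eq0 gt_eqF.
exact: (ler_genus_kernel q zn0 tz).
Qed.

End bal_kernel.

(** * Integral bounds for the kernel over [-r, r] *)

Section bal_kernel_estimates.
Context {R : realType}.
Implicit Types (z : R * R) (t r : R).
Local Notation leb := (@lebesgue_measure R).
Local Notation sitv r := [set` `[(- r)%R, r%R]].

Lemma measurable_bal_kernel_section q z :
  measurable_fun setT (fun t => bal_kernel q (z, t)).
Proof. exact: (measurableT_comp (measurable_bal_kernel q)). Qed.

(** In genus 0 the kernel is the Poisson kernel of the upper half-plane; this form shows its sign
    and its primitive. *)
Lemma bal_kernel0E z t :
  bal_kernel 0 (z, t) = pi^-1 * (z.2 / ((t - z.1) ^+ 2 + z.2 ^+ 2)).
Proof.
by rewrite /bal_kernel big_geq// addr0 /toC/= sub0r sqrrN mulNr opprK.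
Qed.

Lemma bal_kernelE q z t : bal_kernel q (z, t) = bal_kernel 0 (z, t)
  + pi^-1 * \sum_(1 <= k < q.+1) complex.Im (toC z ^- k) * t ^+ k.-1.
Proof. by rewrite /bal_kernel [in X in _ = X + _]big_geq// addr0 mulrDr. Qed.

Lemma bal_kernel0_ge0 z t : Cup z -> 0 <= bal_kernel 0 (z, t).
Proof.
move=> z0; rewrite bal_kernel0E mulr_ge0 ?invr_ge0 ?pi_ge0//.
by rewrite divr_ge0 ?addr_ge0 ?sqr_ge0// ltW.
Qed.

(** The Poisson kernel at x + iy has the primitive atan((t - x)/y)/pi, and the arctangent varies by
    less than pi. *)
Lemma poisson_integral_le1 z r : Cup z -> 0 < r ->
  (\int[leb]_(t in (sitv r)) (bal_kernel 0 (z, t))%:E <= 1)%E.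
Proof.
case: z => x y; rewrite /Cup/= => y0 r0.
have y0' : y != 0 by rewrite gt_eqF.
(* [f] is the Poisson kernel in the shape that the chain rule produces for the derivative of [F]. *)
pose f t := pi^-1 * ((oneDsqr (y^-1 * (t - x)))^-1 * y^-1).
pose F t : R := pi^-1 * atan (y^-1 * (t - x)).
have dF t : is_derive t 1 F (f t).
  have dg : is_derive t (1 : R) (fun s : R => y^-1 *: (s - x)) y^-1.
    by apply: is_derive_eq; rewrite subr0 /GRing.scale/= mulr1.
  exact: (@is_deriveZ _ _ _ _ pi^-1 t 1 _
    (@is_derive1_comp _ _ _ _ _ _ (is_derive1_atan _) dg)).
have cf : continuous f.
  move=> t; apply: cvgM; first exact: cvg_cst.
  apply: cvgM; last exact: cvg_cst.
  apply: (@continuous_comp _ _ _ (fun s : R => y^-1 * (s - x))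
    (fun u : R => (oneDsqr u)^-1)); last exact: continuous_oneDsqrV.
  by apply: cvgM; [exact: cvg_cst|apply: cvgB; [exact: cvg_id|exact: cvg_cst]].
have cF : continuous F.
  move=> t; apply: differentiable_continuous; apply/derivable1_diffP.
  by have [] := dF t.
rewrite (_ : (\int[leb]_(t in (sitv r)) _)%E =
             (\int[leb]_(t in (sitv r)) (f t)%:E)%E); last first.
  apply: eq_integral => t _; rewrite bal_kernel0E/= /f /=; congr EFin.
  congr (_ * _); rewrite /oneDsqr/=. field.
  by rewrite y0'/= gt_eqF// ltr_pwDl ?exprn_gt0// sqr_ge0.
rewrite (@continuous_FTC2 _ f F).
- rewrite -EFinB lee_fin /F -mulrBr mulrC ler_pdivrMr ?pi_gt0// mul1r.
  have := atan_ltpi2 (y^-1 * (r - x)); have := atan_gtNpi2 (y^-1 * (- r - x)).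
  lra.
- lra.
- by apply: continuous_subspaceT.
- split; first by move=> t _; have [] := dF t.
  + by apply: cvg_at_right_filter; exact: cF.
  + by apply: cvg_at_left_filter; exact: cF.
- by move=> t _; rewrite derive1E; exact: (@derive_val _ _ _ _ _ _ _ (dF t)).
Qed.

(** The Poisson term contributes at most 1, however close z is to the real axis. Each remaining term
    is bounded on [-r, r] by its value at |t| = r, and 2 r is the length of the interval. *)
Lemma integral_bal_kernel_near q z r : Cup z -> 0 < r ->
  (\int[leb]_(t in (sitv r)) `|bal_kernel q (z, t)|%:E <=
   (1 + 2 * r * (pi^-1 *
      \sum_(1 <= k < q.+1) `|complex.Im (toC z ^- k)| * r ^+ k.-1))%:E)%E.
Proof.
move=> z0 r0; set S := \sum_(_ <= _ < _) _.
have S0 : 0 <= S.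
  by apply: sumr_ge0 => k _; rewrite mulr_ge0// exprn_ge0// ltW.
have pS0 : 0 <= pi^-1 * S by rewrite mulr_ge0// invr_ge0 pi_ge0.
have mk : measurable_fun (sitv r) (fun t => bal_kernel 0 (z, t)).
  by apply: measurable_funTS; exact: measurable_bal_kernel_section.
apply: (@le_trans _ _ (\int[leb]_(t in (sitv r))
    ((bal_kernel 0 (z, t))%:E + (pi^-1 * S)%:E))%E).
  apply: ge0_le_integral => //.
  - apply/measurable_EFinP; apply: measurableT_comp => //.
    by apply: measurable_funTS; exact: measurable_bal_kernel_section.
  - by apply: emeasurable_funD => //; exact/measurable_EFinP.
  - move=> t /=; rewrite in_itv/= => /andP[rt tr].
    rewrite -EFinD lee_fin bal_kernelE (le_trans (ler_normD _ _))//.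
    rewrite ger0_norm ?bal_kernel0_ge0// lerD2l normrM ger0_norm ?invr_ge0 ?pi_ge0//.
    rewrite ler_wpM2l ?invr_ge0 ?pi_ge0// (le_trans (ler_norm_sum _ _ _))//.
    apply: ler_sum => k _; rewrite normrM ler_wpM2l// normrX lerXn2r ?nnegrE//.
      exact: ltW.
    by rewrite ler_norml rt.
rewrite ge0_integralD//; last 2 first.
- by move=> t _; rewrite lee_fin bal_kernel0_ge0.
- exact/measurable_EFinP.
rewrite EFinD leeD ?poisson_integral_le1// integral_cst//=.
rewrite lebesgue_measure_itv/= lte_fin ifT; last lra.
by rewrite -EFinB -EFinM lee_fin opprK; lra.
Qed.

(** All of [-r, r] lies in the regime |t| <= |z|/2. The pointwise bound at |t| = r times the length
    2 r gives 4/pi and the power r^(q+1). *)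
Lemma integral_bal_kernel_far q z r : 0 < r -> 2 * r <= cabs z ->
  (\int[leb]_(t in (sitv r)) `|bal_kernel q (z, t)|%:E <=
   (4 * pi^-1 * r ^+ q.+1 * cabs z ^- q.+1)%:E)%E.
Proof.
move=> r0 rz; have z0 : 0 < cabs z by lra.
set C := 2 * pi^-1 * r ^+ q * cabs z ^- q.+1.
have C0 : 0 <= C.
  by rewrite /C !mulr_ge0 ?invr_ge0 ?pi_ge0 ?exprn_ge0//; exact: ltW.
apply: (@le_trans _ _ (\int[leb]_(t in (sitv r)) C%:E)%E).
  apply: ge0_le_integral => //.
  - apply/measurable_EFinP; apply: measurableT_comp => //.
    by apply: measurable_funTS; exact: measurable_bal_kernel_section.
  - move=> t /=; rewrite in_itv/= => /andP[rt tr]; rewrite lee_fin.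
    have tr' : `|t| <= r by rewrite ler_norml rt.
    apply: (le_trans (ler_bal_kernel q z0 _)); first lra.
    apply: ler_wpM2r; first by rewrite invr_ge0 exprn_ge0// ltW.
    apply: ler_wpM2l; first by rewrite mulr_ge0// invr_ge0 pi_ge0.
    by rewrite lerXn2r ?nnegrE// ltW.
rewrite integral_cst//= lebesgue_measure_itv/= lte_fin ifT; last lra.
rewrite -EFinB -EFinM lee_fin opprK /C.
rewrite le_eqVlt; apply/orP; left; apply/eqP; rewrite [r ^+ q.+1]exprS; ring.
Qed.

End bal_kernel_estimates.

(** * Integrability of the kernel *)

Section planar_sets.
Context {R : realType}.

Lemma measurable_cabs : measurable_fun setT (@cabs R).
Proof.
apply: (measurableT_comp (f := @Num.sqrt R)).
  by apply: continuous_measurable_fun; exact: sqrt_continuous.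
by apply: measurable_funD; apply: measurable_funX.
Qed.

Lemma measurable_Cup : measurable (@Cup R).
Proof.
rewrite /Cup (_ : [set _ | _] = snd @^-1` `]0, +oo[); last first.
  by apply/seteqP; split => z /=; rewrite in_itv/= andbT.
by rewrite -[_ @^-1` _]setTI; exact: measurable_snd.
Qed.

Lemma measurable_cabs_itv (i : interval R) :
  measurable [set z : R * R | cabs z \in i].
Proof.
rewrite -[[set _ | _]]setTI; apply: (measurable_cabs _ (Y := [set` i])) => //.
Qed.

Lemma measurable_odisc (r : R) : measurable (odisc r).
Proof.
rewrite (_ : odisc r = [set z | cabs z \in `]-oo, r[]).
  exact: measurable_cabs_itv.
by apply/seteqP; split => z /=; rewrite in_itv.
Qed.

Lemma measurable_cdisc (r : R) : measurable (cdisc r).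
Proof.
rewrite (_ : cdisc r = [set z | cabs z \in `]-oo, r]]).
  exact: measurable_cabs_itv.
by apply/seteqP; split => z /=; rewrite in_itv.
Qed.

Lemma measurable_cabs_ge (r : R) : measurable [set z : R * R | r <= cabs z].
Proof.
rewrite (_ : [set _ | _] = [set z | cabs z \in `[r, +oo[]).
  exact: measurable_cabs_itv.
by apply/seteqP; split => z /=; rewrite in_itv/= andbT.
Qed.

Lemma measurable_real_trace (B : set (R * R)) :
  measurable B -> measurable (real_trace B).
Proof.
move=> mB; rewrite -[real_trace B]setTI.
have mg : measurable_fun setT (fun t : R => (t, 0 : R)).
  by apply/measurable_fun_pair; [exact: measurable_id|exact: measurable_cst].
exact: mg.
Qed.

Lemma real_trace_cdisc (B : set (R * R)) r : B `<=` cdisc r ->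
  real_trace B `<=` [set` `[- r, r]].
Proof.
move=> Br t /Br; rewrite /cdisc/= /cabs/= expr0n/= addr0 sqrtr_sqr.
by rewrite in_itv/= ler_norml.
Qed.

Lemma ler_norm_Im_toCV (z : R * R) k (r : R) : 0 < r -> r <= cabs z ->
  `|complex.Im (toC z ^- k)| <= r ^- k.
Proof.
move=> r0 rz; apply: le_trans (ler_norm_Im _) _.
rewrite ComplexField.Normc.normcV normcX normc_toC.
rewrite lef_pV2 ?posrE ?exprn_gt0 ?(lt_le_trans r0 rz)//.
by rewrite lerXn2r ?nnegrE// ltW// (lt_le_trans r0).
Qed.

End planar_sets.

Section integral_setU_lty.
Context (d : measure_display) (T : measurableType d) (R : realType)
  (mu : {measure set T -> \bar R}).
Local Open Scope ereal_scope.

Lemma ge0_integral_setU_lty (A B : set T) (f : T -> \bar R) :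
  measurable A -> measurable B -> measurable_fun setT f -> (forall x, 0 <= f x) ->
  \int[mu]_(x in A) f x < +oo -> \int[mu]_(x in B) f x < +oo ->
  \int[mu]_(x in A `|` B) f x < +oo.
Proof.
move=> mA mB mf f0 fA fB.
have -> : A `|` B = A `|` (B `\` A) by rewrite setDE setUIr setUCr setIT.
have mBA : measurable (B `\` A) by exact: measurableD.
rewrite ge0_integral_setU//; last 2 first.
- exact: measurable_funTS.
- by rewrite disj_set2E setDIK.
apply: lte_add_pinfty => //; apply: le_lt_trans fB.
by apply: ge0_subset_integral => //; exact: measurable_funTS.
Qed.

End integral_setU_lty.

(** * Total mass swept onto an interval *)

Section sweep_estimates.
Context {R : realType} (q : nat) (m : {measure set (R * R) -> \bar R}).
Local Notation leb := (@lebesgue_measure R).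
Local Notation sitv r := [set` `[(- r)%R, r%R]].
Local Open Scope ereal_scope.

(** For z in [Cup] this is the total variation of [Omega q z] on [-r, r]. Being extended real, it
    can be integrated in z before anything is known to be finite. *)
Definition bal_mass (r : R) (z : R * R) : \bar R :=
  \int[leb]_(t in sitv r) `|bal_kernel q (z, t)|%:E.

Lemma bal_mass_ge0 r z : 0 <= bal_mass r z.
Proof. by apply: integral_ge0 => t _; rewrite lee_fin. Qed.

Lemma measurable_bal_mass r : measurable_fun setT (bal_mass r).
Proof.
apply: (@measurable_fun_section_integral _ _ _ _ _ leb
  (fun p : R * R * R => `|bal_kernel q p|%:E)) => //.
by apply/measurable_EFinP; apply: measurableT_comp => //; exact: measurable_bal_kernel.
Qed.

Hypothesis mfin : forall r : R, m (cdisc r) < +oo.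

Lemma bounded_lty (B : set (R * R)) : measurable B -> Defs.bounded_set B -> m B < +oo.
Proof.
move=> mB [r Br]; apply: le_lt_trans (mfin r).
by apply: le_measure => //; rewrite inE//; exact: measurable_cdisc.
Qed.

Hypothesis class_lty :
  \int[m]_(z in Cup `&` [set z | (1 <= cabs z)%R]) (cabs z ^- q.+1)%:E < +oo.

Lemma measurable_cabsX : measurable_fun setT (fun z : R * R => (cabs z ^- q.+1)%:E).
Proof.
apply/measurable_EFinP.
rewrite (_ : (fun _ => _) = (fun z : R * R => (cabs z ^+ q.+1) `^ (-1))%R).
  apply: (measurableT_comp (f := fun y : R => (y `^ (-1))%R)).
    exact: measurable_powR.
  by apply: measurable_funX; exact: measurable_cabs.
by apply/funext => z; rewrite powR_inv1// exprn_ge0// sqrtr_ge0.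
Qed.

(** Moving the threshold from 1 down to r adds at most the shell r <= |z| < 1, where the weight is
    at most r^-(q+1) and the measure is finite. *)
Lemma class_lty_ge (r : R) : (0 < r)%R ->
  \int[m]_(z in Cup `&` [set z | (r <= cabs z)%R]) (cabs z ^- q.+1)%:E < +oo.
Proof.
move=> r0.
have c0 (z : R * R) : 0 <= (cabs z ^- q.+1)%:E.
  by rewrite lee_fin invr_ge0 exprn_ge0// sqrtr_ge0.
pose B := Cup `&` ([set z : R * R | (r <= cabs z)%R] `&` odisc 1).
have mB : measurable B.
  apply: measurableI; first exact: measurable_Cup.
  by apply: measurableI; [exact: measurable_cabs_ge|exact: measurable_odisc].
have m1 : measurable (Cup `&` [set z : R * R | (1 <= cabs z)%R]).
  by apply: measurableI; [exact: measurable_Cup|exact: measurable_cabs_ge].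
apply: (@le_lt_trans _ _ (\int[m]_(z in
    (Cup `&` [set z | (1 <= cabs z)%R]) `|` B) (cabs z ^- q.+1)%:E)).
  apply: ge0_subset_integral => //.
  - by apply: measurableI; [exact: measurable_Cup|exact: measurable_cabs_ge].
  - exact: measurableU.
  - by apply: measurable_funTS; exact: measurable_cabsX.
  - move=> z [Cz rz]; have [z1|z1] := leP 1%R (cabs z); first by left.
    by right.
apply: ge0_integral_setU_lty => //; first exact: measurable_cabsX.
apply: (@le_lt_trans _ _ (\int[m]_(z in B) (r ^- q.+1)%:E)).
  apply: ge0_le_integral => //.
  - by apply: measurable_funTS; exact: measurable_cabsX.
  - move=> z [_ [/= rz _]]; rewrite lee_fin lef_pV2 ?posrE ?exprn_gt0//.
      by rewrite lerXn2r// nnegrE ltW// (lt_le_trans r0).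
    exact: lt_le_trans rz.
rewrite integral_cst// lte_mul_pinfty ?lee_fin ?invr_ge0 ?exprn_ge0 ?ltW//.
apply: bounded_lty => //; exists 1%R => z [_ [_]]; exact: ltW.
Qed.

Lemma bal_mass_far (rho r : R) : (0 < r)%R -> (2 * r <= rho)%R ->
  \int[m]_(z in Cup `&` [set z | (rho <= cabs z)%R]) bal_mass r z <=
  (4 * pi^-1 * r ^+ q.+1)%:E *
    \int[m]_(z in Cup `&` [set z | (rho <= cabs z)%R]) (cabs z ^- q.+1)%:E.
Proof.
move=> r0 rrho.
have mE : measurable (Cup `&` [set z : R * R | (rho <= cabs z)%R]).
  by apply: measurableI; [exact: measurable_Cup|exact: measurable_cabs_ge].
have C0 : 0 <= (4 * pi^-1 * r ^+ q.+1)%:E.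
  rewrite lee_fin mulr_ge0//; first by rewrite mulr_ge0// invr_ge0 pi_ge0.
  by rewrite exprn_ge0// ltW.
rewrite -ge0_integralZl//; last 2 first.
- by apply: measurable_funTS; exact: measurable_cabsX.
- by move=> z _; rewrite lee_fin invr_ge0 exprn_ge0// sqrtr_ge0.
apply: ge0_le_integral => //.
- by move=> z _; exact: bal_mass_ge0.
- by apply: measurable_funTS; exact: measurable_bal_mass.
- apply: measurable_funTS; apply: measurable_funeM; exact: measurable_cabsX.
- move=> z [_ /= rz]; rewrite -EFinM; apply: integral_bal_kernel_far => //.
  exact: le_trans rz.
Qed.

(** The null disc drops out of the integral, and every remaining z satisfies |z| >= r0 >= 2 r. The
    integral on the right does not depend on r, which yields the order r^(q+1). *)
Lemma bal_mass_vanishing (r0 r : R) : (0 < r)%R -> (2 * r <= r0)%R ->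
  m (odisc r0) = 0 ->
  \int[m]_(z in Cup) bal_mass r z <= (4 * pi^-1 * r ^+ q.+1)%:E *
    \int[m]_(z in Cup `&` [set z | (r0 <= cabs z)%R]) (cabs z ^- q.+1)%:E.
Proof.
move=> r0_gt0 rr0 m0; rewrite (ge0_negligible_integral (measurable_odisc r0))//.
- rewrite (_ : Cup `\` odisc r0 = Cup `&` [set z | (r0 <= cabs z)%R]).
    exact: bal_mass_far.
  apply/seteqP; split => z [Cz /=] rz; split => //=.
    by rewrite leNgt; exact/negP.
  by apply/negP; rewrite -leNgt.
- exact: measurable_Cup.
- by apply: measurable_funTS; exact: measurable_bal_mass.
- by move=> z _; exact: bal_mass_ge0.
Qed.

Hypothesis near_integrable : exists r0 : R, (0 < r0)%R /\
  forall k : nat, (1 <= k <= q)%N ->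
    m.-integrable (odisc r0 `&` Cup) (fun z => (complex.Im (toC z ^- k))%:E).

(** The half-plane is cut into three zones. Near 0 the hypothesis on Im z^-k controls the near
    bound; on a bounded shell away from 0 that bound is constant; beyond [rho] the convergence class
    takes over. *)
Lemma bal_mass_lty (r : R) : (0 < r)%R ->
  \int[m]_(z in Cup) bal_mass r z < +oo.
Proof.
have [r0 [r0_gt0 near]] := near_integrable.
move=> r_gt0.
(* The far estimate asks for [rho] at least 2 r, and the class bound for a positive threshold. *)
pose rho := Num.max 1%R (2 * r)%R.
pose A := odisc r0 `&` @Cup R.
pose B := Cup `&` ([set z : R * R | (r0 <= cabs z)%R] `&` odisc rho).
pose C := Cup `&` [set z : R * R | (rho <= cabs z)%R].
have mA : measurable A.
  by apply: measurableI; [exact: measurable_odisc|exact: measurable_Cup].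
have mB : measurable B.
  apply: measurableI; first exact: measurable_Cup.
  by apply: measurableI; [exact: measurable_cabs_ge|exact: measurable_odisc].
have mC : measurable C.
  by apply: measurableI; [exact: measurable_Cup|exact: measurable_cabs_ge].
have -> : @Cup R = (A `|` B) `|` C.
  apply/seteqP; split => [z Cz|z]; last by case=> [[[]|[]]|[]].
  have [z1|z1] := ltP (cabs z) r0; first by left; left.
  have [z2|z2] := ltP (cabs z) rho; first by left; right.
  by right.
apply: ge0_integral_setU_lty => //; first exact: measurableU.
- exact: measurable_bal_mass.
- exact: bal_mass_ge0.
- apply: ge0_integral_setU_lty => //.
  + exact: measurable_bal_mass.
  + exact: bal_mass_ge0.
  (* [g] is the near bound as a function of z. The range of k is repeated in the filter, in the
     shape of [big_nat_cond], so that the integrability of each term can use 1 <= k <= q. *)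
  + pose g z := (1 + \sum_(1 <= k < q.+1 | (1 <= k < q.+1)%N && true)
      (2 * r * pi^-1 * r ^+ k.-1)%:E * `|(complex.Im (toC z ^- k))%:E|).
    have ig : m.-integrable A g.
      apply: integrableD => //.
        apply/integrableP; split => //; rewrite integral_cst//=.
        rewrite ?abse1 ?normr1 mul1e; apply: bounded_lty => //.
        by exists r0 => z [/ltW].
      apply: integrable_sum => // k; rewrite andbT ltnS => /near ik.
      by apply: integrableZl => //; exact: integrable_abse.
    apply: le_lt_trans (integrable_lty mA ig).
    apply: ge0_le_integral => //.
    * by move=> z _; exact: bal_mass_ge0.
    * by apply: measurable_funTS; exact: measurable_bal_mass.
    * by case/integrableP : ig.
    * move=> z [_ Cz]; apply: (le_trans (integral_bal_kernel_near q Cz r_gt0)).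
      rewrite EFinD leeD2l// /g -big_nat_cond.
      under eq_bigr do rewrite abse_EFin -EFinM.
      rewrite sumEFin lee_fin mulr_sumr mulr_sumr.
      by apply: ler_sum => k _; rewrite le_eqVlt; apply/orP; left; apply/eqP; ring.
  (* On the shell |Im z^-k| is at most r0^-k, which turns the near bound into the constant [c]. *)
  + pose c := (1 + 2 * r * (pi^-1 *
      \sum_(1 <= k < q.+1) r0 ^- k * r ^+ k.-1))%R.
    apply: (@le_lt_trans _ _ (\int[m]_(z in B) c%:E)).
      apply: ge0_le_integral => //.
      * by move=> z _; exact: bal_mass_ge0.
      * by apply: measurable_funTS; exact: measurable_bal_mass.
      * move=> z [Cz [/= rz _]]; apply: (le_trans (integral_bal_kernel_near q Cz r_gt0)).
        rewrite lee_fin lerD2l ler_wpM2l//; first lra.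
        rewrite ler_wpM2l ?invr_ge0 ?pi_ge0//.
        apply: ler_sum => k _; apply: ler_wpM2r.
          by rewrite exprn_ge0// ltW.
        exact: ler_norm_Im_toCV.
    rewrite integral_cst// lte_mul_pinfty ?lee_fin//.
      rewrite addr_ge0// mulr_ge0//; first lra.
      rewrite mulr_ge0 ?invr_ge0 ?pi_ge0// sumr_ge0// => k _.
      by rewrite mulr_ge0 ?invr_ge0 ?exprn_ge0// ltW.
    by apply: bounded_lty => //; exists rho => z [_ [_]]; exact: ltW.
- apply: (le_lt_trans (bal_mass_far r_gt0 _)); first by rewrite le_max lexx orbT.
  rewrite lte_mul_pinfty//; last first.
    by apply: class_lty_ge; rewrite lt_max ltr01.
  rewrite lee_fin mulr_ge0//; first by rewrite mulr_ge0// invr_ge0 pi_ge0.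
  by rewrite exprn_ge0// ltW.
Qed.

End sweep_estimates.

(** * Sets covered by null discs *)

Section null_disc.
Context {R : realType}.
Implicit Types (z w : R * R).

Lemma cabsD z w : cabs (z.1 + w.1, z.2 + w.2) <= cabs z + cabs w.
Proof. by rewrite -!normc_toC; exact: (le_normcD (toC z) (toC w)). Qed.

Lemma cabs_le_add (a b : R) : cabs (a, b) <= `|a| + `|b|.
Proof.
rewrite -(ger0_norm (_ : 0 <= `|a| + `|b|))// -sqrtr_sqr ler_wsqrtr//=.
by rewrite sqrrD !real_normK ?num_real// lerD2r lerDl mulrn_wge0// mulr_ge0.
Qed.

Lemma measurable_odisc_at z (e : R) : measurable (odisc_at z e).
Proof.
have mt : measurable_fun setT (fun w => (w.1 - z.1, w.2 - z.2)).
  apply/measurable_fun_pair.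
    exact: (measurable_funB measurable_fst (measurable_cst _)).
  exact: (measurable_funB measurable_snd (measurable_cst _)).
rewrite -[odisc_at z e]setTI.
exact: (mt measurableT _ (measurable_odisc e)).
Qed.

(* Lindeloef's argument, with the discs of rational centre and radius. *)
Lemma null_of_locally_null (m : {measure set (R * R) -> \bar R}) (U : set (R * R)) :
  measurable U ->
  (forall z, U z -> exists2 e : R, 0 < e & m (odisc_at z e) = 0%E) ->
  m U = 0%E.
Proof.
move=> mU Unull; apply: measure_negligible => //.
pose D (p : rat * rat * rat) := odisc_at (ratr p.1.1, ratr p.1.2) (ratr p.2 : R).
(* [F] enumerates the null rational discs; all other indices get the empty set. *)
pose F n := if unpickle n is Some p then
  if m (D p) == 0%E then D p else set0 else set0.
have FD p : m (D p) = 0%E -> exists n, F n = D p.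
  by move=> p0; exists (pickle p); rewrite /F pickleK p0 eqxx.
apply: (@negligibleS _ _ _ _ (\bigcup_n F n)); last first.
  apply: negligible_bigcup => n; rewrite /F.
  case: (unpickle n) => [p|]; last exact: negligible_set0.
  case: eqP => [p0|_]; last exact: negligible_set0.
  by apply/negligibleP => //; exact: measurable_odisc_at.
move=> z /Unull[e e0 ze].
(* An error below e/8 in each coordinate puts the rational centre within e/4 of z. A radius between
   e/4 and e/2 then makes the rational disc contain z and stay inside the disc of radius e, as e/2 +
   e/4 < e. *)
have he : 0 < e / 8 by rewrite divr_gt0.
have [a] : exists a, ratr a \in `]z.1 - e / 8, z.1 + e / 8[.
  by apply: rat_in_itvoo; lra.
have [b] : exists b, ratr b \in `]z.2 - e / 8, z.2 + e / 8[.
  by apply: rat_in_itvoo; lra.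
have [c] : exists c, ratr c \in `]e / 4, e / 2[ by apply: rat_in_itvoo; lra.
rewrite !in_itv/= => /andP[c1 c2] /andP[b1 b2] /andP[a1 a2].
have zw : cabs (z.1 - ratr a, z.2 - ratr b) < e / 4.
  apply: le_lt_trans (cabs_le_add _ _) _.
  have : `|z.1 - ratr a| < e / 8 by rewrite ltr_norml; apply/andP; split; lra.
  have : `|z.2 - ratr b| < e / 8 by rewrite ltr_norml; apply/andP; split; lra.
  lra.
have wz : cabs (ratr a - z.1, ratr b - z.2) < e / 4.
  apply: le_lt_trans (cabs_le_add _ _) _.
  have : `|ratr a - z.1| < e / 8 by rewrite ltr_norml; apply/andP; split; lra.
  have : `|ratr b - z.2| < e / 8 by rewrite ltr_norml; apply/andP; split; lra.
  lra.
have [n FnD] : exists n, F n = D (a, b, c).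
  apply: FD; apply/eqP; rewrite -measure_le0 -ze.
  apply: le_measure; rewrite ?inE.
  - exact: measurable_odisc_at.
  - exact: measurable_odisc_at.
  move=> u; rewrite /D /odisc_at/= => uw.
  have := cabsD (u.1 - ratr a, u.2 - ratr b) (ratr a - z.1, ratr b - z.2).
  rewrite /= !addrA !subrK; lra.
exists n; first exact: I.
rewrite FnD /D /odisc_at/=; lra.
Qed.

End null_disc.

(** * The balayage as a charge *)

Section Omega_integral.
Context {R : realType}.
Implicit Types (z : R * R) (B : set (R * R)) (r : R).
Local Notation leb := (@lebesgue_measure R).
Local Notation sitv r := [set` `[(- r)%R, r%R]].

Lemma integrable_bal_kernel q z r : Cup z -> 0 < r ->
  leb.-integrable (sitv r) (fun t => (bal_kernel q (z, t))%:E).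
Proof.
move=> z0 r0; apply/integrableP; split.
  apply/measurable_EFinP/measurable_funTS.
  exact: measurable_bal_kernel_section.
exact: le_lt_trans (integral_bal_kernel_near q z0 r0) (ltry _).
Qed.

Lemma bounded_set_trace B : Defs.bounded_set B ->
  exists2 r, 0 < r & B `<=` cdisc r /\ real_trace B `<=` sitv r.
Proof.
move=> [r Br]; exists (Num.max r 1); first by rewrite lt_max ltr01 orbT.
have BR : B `<=` cdisc (Num.max r 1).
  by move=> z /Br; rewrite /cdisc/= le_max => ->.
by split => //; exact: real_trace_cdisc.
Qed.

Lemma integrable_bal_kernel_trace q z B : Cup z -> measurable B ->
  Defs.bounded_set B ->
  leb.-integrable (real_trace B) (fun t => (bal_kernel q (z, t))%:E).
Proof.
move=> z0 mB /bounded_set_trace[r r0 [_ Br]].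
have mtB := measurable_real_trace mB.
apply: (@integrableS _ _ R leb (sitv r)) => //.
exact: integrable_bal_kernel.
Qed.

Lemma integrable_exprn_trace n B : measurable B -> Defs.bounded_set B ->
  leb.-integrable (real_trace B) (EFin \o (fun t : R => t ^+ n)).
Proof.
move=> mB /bounded_set_trace[r r0 [_ Br]].
have mtB := measurable_real_trace mB.
apply: (@integrableS _ _ R leb (sitv r)) => //.
apply: continuous_compact_integrable; first exact: segment_compact.
by apply: continuous_subspaceT; exact: exprn_continuous.
Qed.

(** [Omega] integrates its terms one by one. They are merged by linearity, one power of t per
    induction step, each term being integrable on the bounded trace. *)
Lemma Omega_bal_kernel q z B : Cup z -> measurable B -> Defs.bounded_set B ->
  Omega q z B = Rintegral leb (real_trace B) (fun t => bal_kernel q (z, t)).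
Proof.
move=> z0 mB bB; have mtB := measurable_real_trace mB.
elim: q => [|q IH].
  rewrite /Omega big_geq// addr0 -RintegralZl//.
    by apply: eq_Rintegral => t _; rewrite /bal_kernel big_geq// addr0.
  (* Im 1/(t - z) is pi times the kernel of genus 0, hence integrable. *)
  have := @integrableZl _ _ _ leb _ mtB pi _ (integrable_bal_kernel_trace 0 z0 mB bB).
  apply: eq_integrable => // t _.
  by rewrite /bal_kernel big_geq// addr0 -EFinM mulVKf// gt_eqF// pi_gt0.
rewrite /Omega big_nat_recr//= addrA mulrDr -/(Omega q z B) IH mulrA.
have it := integrable_exprn_trace q mB bB.
rewrite -RintegralZl// -RintegralD//.
- apply: eq_Rintegral => t _.
  by rewrite (bal_kernelE q) (bal_kernelE q.+1) [in RHS]big_nat_recr//=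
    mulrDr addrA mulrA.
- exact: integrable_bal_kernel_trace.
- exact: (@integrableZl _ _ _ leb _ mtB _ _ it).
Qed.

End Omega_integral.

(** This sweeps a single positive measure. [sp] and [sn] integrate the positive and the negative
    part of the kernel over t and then z; both parts are at most the absolute value of the kernel,
    so [bal_mass] bounds them on discs. The bound is kept explicit for the growth estimate near
    0. *)
Lemma sweep_decomposition (R : realType) (q : nat)
    (m : {measure set (R * R) -> \bar R}) :
  (forall r : R, 0 < r -> (\int[m]_(z in Cup) bal_mass q r z < +oo)%E) ->
  exists sp sn : {measure set (R * R) -> \bar R},
    (forall r : R, (sp (cdisc r) <= \int[m]_(z in Cup) bal_mass q r z)%E /\
                   (sn (cdisc r) <= \int[m]_(z in Cup) bal_mass q r z)%E) /\
    forall B : set (R * R), measurable B -> Defs.bounded_set B ->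
      [/\ (sp B < +oo)%E, (sn B < +oo)%E,
        m.-integrable Cup (fun z => (Omega q z B)%:E) &
        Rintegral m Cup (fun z => Omega q z B) = fine (sp B) - fine (sn B)].
Proof.
move=> mass_lty.
pose leb := @lebesgue_measure R.
pose k := EFin \o @bal_kernel R q.
have mk : measurable_fun setT k by apply/measurable_EFinP; exact: measurable_bal_kernel.
have mkp : measurable_fun setT k^\+%E by exact: measurable_funepos.
have mkn : measurable_fun setT k^\-%E by exact: measurable_funeneg.
(* Embedding the real line in the plane: the preimage of [B] is [real_trace B]. *)
have mg : measurable_fun setT (fun t : R => (t, 0 : R)).
  by apply/measurable_fun_pair; [exact: measurable_id|exact: measurable_cst].
have [sp spE] := @iterated_integral_measure _ _ _ _ _ _ _ m leb _ _ _
  (@measurable_Cup R) mg mkp (funepos_ge0 k).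
have [sn snE] := @iterated_integral_measure _ _ _ _ _ _ _ m leb _ _ _
  (@measurable_Cup R) mg mkn (funeneg_ge0 k).
have le_mass (f : R * R * R -> \bar R) r : measurable_fun setT f ->
    (forall p, (0 <= f p)%E) -> (forall p, (f p <= `|k p|)%E) ->
    (\int[m]_(z in Cup) \int[leb]_(t in real_trace (cdisc r)) f (z, t)
      <= \int[m]_(z in Cup) bal_mass q r z)%E.
  move=> mf f0 fk; have mc := measurable_cdisc r.
  apply: ge0_le_integral.
  - exact: measurable_Cup.
  - by move=> z _; exact: integral_ge0.
  - apply: measurable_funTS; apply: measurable_fun_section_integral => //.
    exact: measurable_real_trace.
  - by apply: measurable_funTS; exact: measurable_bal_mass.
  move=> z _; apply: (@le_trans _ _
      (\int[leb]_(t in real_trace (cdisc r)) `|k (z, t)|)%E).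
    apply: ge0_le_integral => //; first exact: measurable_real_trace.
    - by apply: measurable_funTS; exact: measurableT_comp.
    - apply: measurableT_comp => //; apply: measurable_funTS.
      exact: measurableT_comp.
  apply: ge0_subset_integral => //; first exact: measurable_real_trace.
  - apply: measurableT_comp => //; apply: measurable_funTS.
    exact: measurableT_comp.
  - exact: real_trace_cdisc.
have kpk p : (k^\+ p <= `|k p|)%E by rewrite funeposE ge_max lee_abs abse_ge0.
have knk p : (k^\- p <= `|k p|)%E.
  by rewrite funenegE ge_max -abseN lee_abs abse_ge0.
exists sp, sn; split.
  by move=> r; rewrite spE snE; split; exact: le_mass.
move=> B mB bB.
have [r r0 [Br _]] := bounded_set_trace bB.
have mtB := measurable_real_trace mB.
have slty (s : {measure set (R * R) -> \bar R}) :
    (s (cdisc r) <= \int[m]_(z in Cup) bal_mass q r z)%E -> (s B < +oo)%E.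
  move=> sr; apply: le_lt_trans (mass_lty r r0); apply: le_trans sr.
  by apply: le_measure; rewrite ?inE//; exact: measurable_cdisc.
have spB : (sp B < +oo)%E by apply: slty; rewrite spE; exact: le_mass.
have snB : (sn B < +oo)%E by apply: slty; rewrite snE; exact: le_mass.
pose Hp z := (\int[leb]_(t in real_trace B) k^\+ (z, t))%E.
pose Hn z := (\int[leb]_(t in real_trace B) k^\- (z, t))%E.
have mHp : measurable_fun setT Hp by exact: measurable_fun_section_integral.
have mHn : measurable_fun setT Hn by exact: measurable_fun_section_integral.
have Hp0 z : (0 <= Hp z)%E by exact: integral_ge0.
have Hn0 z : (0 <= Hn z)%E by exact: integral_ge0.
have iHp : m.-integrable Cup Hp.
  apply/integrableP; split; first exact: measurable_funTS.
  by under eq_integral do rewrite gee0_abs//; rewrite -[X in (X < _)%E]spE.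
have iHn : m.-integrable Cup Hn.
  apply/integrableP; split; first exact: measurable_funTS.
  by under eq_integral do rewrite gee0_abs//; rewrite -[X in (X < _)%E]snE.
(* Integrability of the kernel on the trace makes both [Hp z] and [Hn z] finite here, so their
   difference is the integral of the kernel. *)
have OE z : Cup z -> (Omega q z B)%:E = (Hp z - Hn z)%E.
  move=> Cz; have ik := integrable_bal_kernel_trace q Cz mB bB.
  rewrite Omega_bal_kernel// /Rintegral fineK; last exact: integrable_fin_num.
  by rewrite -[X in integral _ _ X]/(k \o (fun t : R => (z, t))) integralE
    funepos_comp funeneg_comp.
split => //.
- have := integrableB (measurable_Cup) iHp iHn.
  by apply: eq_integrable => [|z]; [exact: measurable_Cup|rewrite inE => /OE].
- rewrite /Rintegral (eq_integral (Hp \- Hn)%E); last by move=> z; rewrite inE => /OE.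
  rewrite integralB//; last exact: measurable_Cup.
  by rewrite -spE -snE fineB// ge0_fin_numE// measure_ge0.
Qed.

(** * Charges from differences of measures, and total variation *)

Section charge_difference.
Context {R : realType}.
Implicit Types P N : {measure set (R * R) -> \bar R}.

(** The annuli n <= |z| < n+1 are disjoint and of finite measure, and every disc lies in finitely
    many of them, so the glued decomposition is valid on all bounded sets. *)
Lemma charge_difference P N :
  (forall r : R, P (cdisc r) < +oo)%E -> (forall r : R, N (cdisc r) < +oo)%E ->
  exists mup mun : {measure set (R * R) -> \bar R},
    is_charge mup mun /\
    forall B, measurable B -> Defs.bounded_set B ->
      charge_val mup mun B = fine (P B) - fine (N B).
Proof.
move=> Pfin Nfin.
pose A n := [set z : R * R | cabs z \in `[n%:R, n.+1%:R[].
(* The integer part of |z| is the index of its annulus; this gives disjointness, and below the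
   covering. *)
have AE n z : A n z -> Num.truncn (cabs z) = n.
  by rewrite /A/= in_itv/= => /truncn_def.
have mA n : measurable (A n) by exact: measurable_cabs_itv.
have Acdisc n : A n `<=` cdisc n.+1%:R.
  by move=> z; rewrite /A/= in_itv/= => /andP[_ /ltW].
have cdiscA r n : r < n%:R -> cdisc r `<=` \bigcup_(i < n) A i.
  move=> rn z zr; have /andP[z1 z2] := truncn_itv (sqrtr_ge0 _ : 0 <= cabs z).
  exists (Num.truncn (cabs z)); last by rewrite /A/= in_itv/= z1.
  by rewrite /= -(ltr_nat R) (le_lt_trans z1)// (le_lt_trans zr).
have bound (r : R) : exists n : nat, r < n%:R.
  by exists (Num.truncn r).+1; exact: truncnS_gt.
have Afin (Q : {measure set (R * R) -> \bar R}) n :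
    (forall r : R, Q (cdisc r) < +oo)%E -> (Q (A n) < +oo)%E.
  move=> Qfin; apply: le_lt_trans (Qfin n.+1%:R).
  by apply: le_measure; rewrite ?inE//; exact: measurable_cdisc.
have [||||mup [mun [[D [mD Dp Dn]] glue]]] :=
  @sigma_finite_jordan_decomposition _ _ _ P N A mA.
- by move=> i j _ _ [z [/AE <- /AE <-]].
- by move=> n; exact: Afin.
- by move=> n; exact: Afin.
- rewrite -subTset => z _; have [n /cdiscA] := bound (cabs z).
  by move=> /(_ z (lexx _))[i _ Aiz]; exists i.
exists mup, mun; split.
  split; last by exists D; split.
  move=> r; have [n rn] := bound r.
  by have [] := glue n _ (measurable_cdisc r) (cdiscA _ _ rn).
move=> B mB [r Br]; have [n rn] := bound r.
by have [_ _] := glue n _ mB (subset_trans Br (cdiscA _ _ rn)).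
Qed.

(** Over any finite partition the sum of |mu(F i)| is at most the sum of the Q(F i), which is Q(A).
    Any dominating measure thus bounds the variation, without knowing the Jordan parts of mu. *)
Lemma tvar_le (mu : set (R * R) -> R) (Q : {measure set (R * R) -> \bar R})
    (A : set (R * R)) :
  measurable A -> (Q A < +oo)%E ->
  (forall F, measurable F -> F `<=` A -> `|mu F| <= fine (Q F)) ->
  (tvar mu A <= Q A)%E.
Proof.
move=> mA QA muQ; apply: ge_ereal_sup => _ [n [F [mF [F0 [AF ->]]]]].
have FA i : F i `<=` A by rewrite AF (bigD1 i)//=; left.
have Qfin i : Q (F i) \is a fin_num.
  rewrite ge0_fin_numE ?measure_ge0//; apply: le_lt_trans QA.
  by apply: le_measure; rewrite ?inE.
rewrite AF measure_semi_additive_ord//; last 2 first.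
- by apply/trivIsetP => i j _ _; exact: F0.
- by rewrite -AF.
rewrite -EFin_sum_fine => [|i _]; last exact: Qfin.
rewrite lee_fin; apply: ler_sum => i _.
exact: muQ.
Qed.

End charge_difference.

(** Each point of the disc lies outside the support and so has a null disc around it. The disc is
    then null for [nup] + [nun], hence for each of these nonnegative measures. *)
Lemma charge_abs_supp0 (R : realType) (nup nun : {measure set (R * R) -> \bar R})
    (r0 : R) :
  odisc r0 `&` charge_supp nup nun = set0 ->
  nup (odisc r0) = 0%E /\ nun (odisc r0) = 0%E.
Proof.
move=> supp0.
have : charge_abs nup nun (odisc r0) = 0%E.
  apply: (null_of_locally_null (m := charge_abs nup nun)) => [|z zr].
    exact: measurable_odisc.
  apply: contrapT => nz; have : (odisc r0 `&` charge_supp nup nun) z.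
    split => // e e0; rewrite lt_neqAle measure_ge0 andbT eq_sym.
    by apply/eqP => z0; apply: nz; exists e.
  by rewrite supp0.
rewrite /charge_abs measure_addE => /eqP.
by rewrite padde_eq0 ?measure_ge0// => /andP[/eqP -> /eqP ->].
Qed.

Unset Implicit Arguments.

(** * Existence of the balayage and its growth near 0 *)

Theorem theorem1 (R : realType) (q : nat)
    (nup nun : {measure set (R * R)%type -> \bar R}) :
  is_charge nup nun ->
  (exists r0 : R, 0 < r0 /\
     forall k : nat, (1 <= k <= q)%N ->
       nup.-integrable (odisc r0 `&` Cup) (fun z => (complex.Im (toC z ^- k))%:E) /\
       nun.-integrable (odisc r0 `&` Cup) (fun z => (complex.Im (toC z ^- k))%:E)) ->
  (\int[charge_abs nup nun]_(z in Cup `&` [set z | (1 <= cabs z)%R])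
      ((cabs z) ^- q.+1)%R%:E < +oo)%E ->
  bal_exists q nup nun /\
  ((exists r0 : R, 0 < r0 /\ odisc r0 `&` charge_supp nup nun = set0) ->
   exists (c delta : R), 0 < delta /\
     forall t : R, 0 < t < delta ->
       (tvar (bal q nup nun) (cdisc t) <= (c * t ^+ q.+1)%:E)%E).
Proof.
move=> [fin _] [rho [rho0 near]].
have mE : measurable (Cup `&` [set z : R * R | 1 <= cabs z]).
  by apply: measurableI; [exact: measurable_Cup|exact: measurable_cabs_ge].
have c0 (z : R * R) : (0 <= (cabs z ^- q.+1)%:E)%E.
  by rewrite lee_fin invr_ge0 exprn_ge0// sqrtr_ge0.
rewrite /charge_abs ge0_integral_measure_add//; last first.
  by apply: measurable_funTS; exact: measurable_cabsX.
move=> class.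
have finp r : (nup (cdisc r) < +oo)%E by case: (fin r).
have finn r : (nun (cdisc r) < +oo)%E by case: (fin r).
have classp : (\int[nup]_(z in Cup `&` [set z | (1 <= cabs z)%R])
    ((cabs z) ^- q.+1)%R%:E < +oo)%E.
  by apply: le_lt_trans class; rewrite leeDl// integral_ge0.
have classn : (\int[nun]_(z in Cup `&` [set z | (1 <= cabs z)%R])
    ((cabs z) ^- q.+1)%R%:E < +oo)%E.
  by apply: le_lt_trans class; rewrite leeDr// integral_ge0.
have massp r : 0 < r -> (\int[nup]_(z in Cup) bal_mass q r z < +oo)%E.
  apply: bal_mass_lty => //; exists rho; split => // k kq.
  by case: (near k kq).
have massn r : 0 < r -> (\int[nun]_(z in Cup) bal_mass q r z < +oo)%E.
  apply: bal_mass_lty => //; exists rho; split => // k kq.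
  by case: (near k kq).
have [pp [pn [pmass pB]]] := sweep_decomposition massp.
have [np [nn [nmass nB]]] := sweep_decomposition massn.
have mCupC : measurable (~` @Cup R) by apply: measurableC; exact: measurable_Cup.
(* Sweeping [nup] gives [pp] - [pn], and [nun], which enters with a minus sign, gives [np] - [nn].
   Hence [nn] joins the positive side and [np] the negative one, along with the unswept parts off
   [Cup]. *)
pose P := measure_add (measure_add pp nn) (mrestr nup mCupC).
pose N := measure_add (measure_add pn np) (mrestr nun mCupC).
have PE B : P B = (pp B + nn B + nup (B `\` Cup))%E 
  by rewrite /P measure_addE [X in (X + _)%E](measure_addE pp nn) /= /mrestr setDE.
have NE B : N B = (pn B + np B + nun (B `\` Cup))%E 
  by rewrite /N measure_addE [X in (X + _)%E](measure_addE pn np) /= /mrestr setDE.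
have outer_fin (m : {measure set (R * R) -> \bar R}) (B : set (R * R)) :
    (forall r, m (cdisc r) < +oo)%E -> measurable B -> Defs.bounded_set B ->
    (m (B `\` Cup) < +oo)%E.
  move=> mfin mB [r Br]; apply: bounded_lty => //.
    by apply: measurableD => //; exact: measurable_Cup.
  by exists r => z [/Br].
have Pfin B : measurable B -> Defs.bounded_set B -> (P B < +oo)%E.
  move=> mB bB; have [? _ _ _] := pB B mB bB; have [_ ? _ _] := nB B mB bB.
  by rewrite PE !lte_add_pinfty//; exact: outer_fin.
have Nfin B : measurable B -> Defs.bounded_set B -> (N B < +oo)%E.
  move=> mB bB; have [_ ? _ _] := pB B mB bB; have [? _ _ _] := nB B mB bB.
  by rewrite NE !lte_add_pinfty//; exact: outer_fin.
have balE B : measurable B -> Defs.bounded_set B ->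
    bal q nup nun B = fine (P B) - fine (N B).
  move=> mB bB; have [fpp fpn _ pE] := pB B mB bB.
  have [fnp fnn _ nE] := nB B mB bB.
  have fp := outer_fin nup B finp mB bB; have fn := outer_fin nun B finn mB bB.
  rewrite /bal pE nE /charge_val PE NE.
  have fE (m : {measure set (R * R) -> \bar R}) X : (m X < +oo)%E -> m X \is a fin_num.
    by rewrite ge0_fin_numE.
  move: (fE _ _ fpp) (fE _ _ fpn) (fE _ _ fnp) (fE _ _ fnn) (fE _ _ fp) (fE _ _ fn).
  move=> {}fpp {}fpn {}fnp {}fnn {}fp {}fn.
  rewrite !fineD ?fin_numD ?fpp ?fpn ?fnp ?fnn//; lra.
have bcdisc (r : R) : Defs.bounded_set (cdisc r) by exists r.
split.
  split=> [B mB bB|].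
    by have [_ _ ? _] := pB B mB bB; have [_ _ ? _] := nB B mB bB.
  have [||mup [mun [chg mE']]] := @charge_difference _ P N.
  - by move=> r; apply: Pfin => //; exact: measurable_cdisc.
  - by move=> r; apply: Nfin => //; exact: measurable_cdisc.
  by exists mup, mun; split => // B mB bB; rewrite mE'// balE.
move=> [r0 [r0_gt0 /charge_abs_supp0[nup0 nun0]]].
pose M (m : {measure set (R * R) -> \bar R}) :=
  (\int[m]_(z in Cup `&` [set z : R * R | (r0 <= cabs z)%R])
    (cabs z ^- q.+1)%:E)%E.
have Mp : (M nup < +oo)%E by exact: class_lty_ge.
have Mn : (M nun < +oo)%E by exact: class_lty_ge.
have Mp0 : (0 <= M nup)%E by exact: integral_ge0.
have Mn0 : (0 <= M nun)%E by exact: integral_ge0.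
have Mpf : M nup \is a fin_num by rewrite ge0_fin_numE.
have Mnf : M nun \is a fin_num by rewrite ge0_fin_numE.
(* [P] and [N] each have mass at most 4/pi t^(q+1) (M nup + M nun) on the disc of radius t, hence
   the factor 2. The bound t < r0/2 is the condition 2 t <= r0 of the far estimate. *)
exists (2 * (4 * pi^-1) * (fine (M nup) + fine (M nun))), (r0 / 2).
split; first by rewrite divr_gt0.
move=> t /andP[t0 tr0].
(* The balayage is P - N on bounded sets, so P + N dominates its variation. *)
pose Q : {measure set (R * R) -> \bar R} := measure_add P N.
have QE B : Q B = (P B + N B)%E by exact: (measure_addE P N).
have mct := @measurable_cdisc R t.
have tvarQ : (tvar (bal q nup nun) (cdisc t) <= Q (cdisc t))%E.
  apply: (@tvar_le _ _ Q) => //.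
    by rewrite QE lte_add_pinfty//; [exact: Pfin|exact: Nfin].
  move=> F mF Ft; have bF : Defs.bounded_set F by exists t.
  have PF := Pfin F mF bF; have NF := Nfin F mF bF.
  rewrite balE// QE fineD ?ge0_fin_numE ?measure_ge0//.
  rewrite (le_trans (ler_normB _ _))// !ger0_norm ?fine_ge0 ?measure_ge0//.
apply: (le_trans tvarQ).
(* The closed disc of radius t lies in the null disc of radius r0, so the unswept parts contribute
   nothing. *)
have outer0 (m : {measure set (R * R) -> \bar R}) :
    m (odisc r0) = 0%E -> m (cdisc t `\` Cup) = 0%E.
  move=> m0; apply/eqP; rewrite -measure_le0 -m0.
  apply: le_measure; rewrite ?inE//.
  - by apply: measurableD => //; exact: measurable_Cup.
  - exact: measurable_odisc.
  by move=> z [zt _]; apply: le_lt_trans zt _; lra.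
have tr : 2 * t <= r0 by lra.
have bp := bal_mass_vanishing q t0 tr nup0.
have bn := bal_mass_vanishing q t0 tr nun0.
rewrite QE PE NE !outer0// !adde0.
have [pp1 pn1] := pmass t; have [np1 nn1] := nmass t.
apply: (@le_trans _ _ ((4 * pi^-1 * t ^+ q.+1)%:E * M nup +
    (4 * pi^-1 * t ^+ q.+1)%:E * M nun + ((4 * pi^-1 * t ^+ q.+1)%:E * M nup +
    (4 * pi^-1 * t ^+ q.+1)%:E * M nun))%E).
  by apply: leeD; apply: leeD; (apply: le_trans; last first; [eassumption|by []]).
rewrite -(fineK Mpf) -(fineK Mnf) -!EFinM -!EFinD lee_fin.
by rewrite le_eqVlt; apply/orP; left; apply/eqP; ring.
Qed.
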